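(* Let $(V,E,c)$ be a connected network with energy Hilbert space $\mathscr{H}_E$ and dipoles $v_{xy}\in\mathscr{H}_E$. Let $E^{(ori)}\subset E$ be any choice of orientation, i.e. for each $(x,y)\in E$ exactly one of $(x,y),(y,x)$ belongs to $E^{(ori)}$. Then the system of vectors $$w_{xy}:=\sqrt{c_{xy}}\,v_{xy},\qquad (x,y)\in E^{(ori)},$$ is a Parseval frame for $\mathscr{H}_E$.
   Context: A connected network $(V,E,c)$ consists of a countable set $V$ of vertices; a set $E\subset V\times V$ of edges such that $(x,y)\in E\iff(y,x)\in E$, $(x,x)\notin E$, each $x\in V$ has a finite nonzero number of neighbours $y$ (those with $(x,y)\in E$, written $y\sim x$), and any two vertices are joined by a finite path of edges; and a conductance function $c:E\to(0,\infty)$, $(x,y)\mapsto c_{xy}$, with $c_{xy}=c_{yx}$. The energy Hilbert space $\mathscr{H}_E$ is the space of functions $u:V\to\mathbb{C}$, modulo constant functions, with $\|u\|_{\mathscr{H}_E}^2=\frac12\sum_{(x,y)\in E}c_{xy}|u(x)-u(y)|^2<\infty$, with inner product (conjugate-linear in the first variable) $\langle u,v\rangle_{\mathscr{H}_E}=\frac12\sum_{(x,y)\in E}c_{xy}\overline{(u(x)-u(y))}(v(x)-v(y))$. It is a Hilbert space. For $x,y\in V$ the dipole $v_{xy}$ is the unique vector in $\mathscr{H}_E$ with $\langle v_{xy},u\rangle_{\mathscr{H}_E}=u(x)-u(y)$ for all $u\in\mathscr{H}_E$. A countable family $\{w_j\}_{j\in J}$ of nonzero vectors in a Hilbert space $\mathscr{H}$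 is a Parseval frame if $\sum_{j\in J}|\langle w_j,u\rangle|^2=\|u\|^2$ for all $u\in\mathscr{H}$. *)

(* Defs.v *)
From HB Require Import structures.
From mathcomp Require Import all_boot all_order all_algebra.
From mathcomp Require Import complex.
From mathcomp Require Import mathcomp_extra boolp classical_sets functions.
From mathcomp Require Import cardinality fsbigop.
From mathcomp Require Import reals ereal esum.
From mathcomp Require Import generic_quotient ring_quotient.
From mathcomp Require Import ring.

Set Implicit Arguments.
Unset Strict Implicit.
Unset Printing Implicit Defensive.
Import Order.TTheory GRing.Theory Num.Theory.
Import ComplexField.Normc.
Local Open Scope classical_set_scope.
Local Open Scope ring_scope.
Local Open Scope complex_scope.
Local Open Scope quotient_scope.

(* The conductance is a total function; its values off the edge set are
   unconstrained and never used. *)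
Record network (R : realType) (V : countType) := Network {
  adj : rel V;
  cond : V -> V -> R;
  adj_sym : forall x y, adj x y = adj y x;
  adj_irr : forall x, ~~ adj x x;
  adj_fin : forall x, finite_set [set y | adj x y];
  adj_ex : forall x, exists y, adj x y;
  adj_conn : forall x y, exists p, path adj x p /\ last x p = y;
  cond_gt0 : forall x y, adj x y -> 0 < cond x y;
  cond_sym : forall x y, adj x y -> cond x y = cond y x
}.

Definition edges (R : realType) (V : countType) (N : network R V) : set (V * V) :=
  [set e | adj N e.1 e.2].

Section Sums.
Context {R : realType} {I : choiceType}.
Implicit Types (D : set I) (f g : I -> R).

(* [esum] is only meant for nonnegative terms: a signed (resp. complex) family
   is summed through its positive and negative (resp. real and imaginary)
   parts. This is the usual unordered sum when the family is absolutely
   summable, which by Cauchy-Schwarz is the case wherever it is used here. *)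
Definition rsum D f : R :=
  fine (\esum_(i in D) (Num.max (f i) 0)%:E) -
  fine (\esum_(i in D) (Num.max (- f i) 0)%:E).

Definition csum D (f : I -> R[i]) : R[i] :=
  rsum D (fun i => complex.Re (f i)) +i* rsum D (fun i => complex.Im (f i)).

Lemma eq_rsum D f g : (forall i, f i = g i) -> rsum D f = rsum D g.
Proof. by move=> /funext ->. Qed.

Lemma rsum_ge0 D f : (forall i, D i -> 0 <= f i) ->
  rsum D f = fine (\esum_(i in D) (f i)%:E).
Proof.
move=> f0; rewrite /rsum [X in _ - fine X]esum1 ?subr0.
  by congr fine; apply: eq_esum => i /f0 fi; rewrite max_l.
by move=> i /f0 fi; rewrite max_r// oppr_le0.
Qed.

Lemma le_esumZ D k f : 0 <= k -> (forall i, D i -> 0 <= f i) ->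
  (\esum_(i in D) (k * f i)%:E <= k%:E * \esum_(i in D) (f i)%:E)%E.
Proof.
move=> k0 f0; apply: ge_ereal_sup => _ [A [finA AD] <-].
rewrite (eq_fsbigr (fun i => k%:E * (Num.max (f i) 0)%:E)%E); last first.
  by move=> i /[!inE] /AD /f0 fi; rewrite max_l// EFinM.
rewrite -ge0_mule_fsumr; last by move=> i; rewrite lee_fin le_max lexx orbT.
apply: lee_wpmul2l; rewrite ?lee_fin//; apply: ereal_sup_ubound.
exists A => //; apply: eq_fsbigr => i /[!inE] /AD /f0 fi.
by rewrite max_l.
Qed.

End Sums.

Section EnergySpace.
Context {R : realType} {V : countType} (N : network R V).
Local Notation C := R[i].
Implicit Types u v : V -> C.

Definition energy u : \bar R :=
  ((2^-1)%:E *
   \esum_(e in edges N) (cond N e.1 e.2 * normc (u e.1 - u e.2) ^+ 2)%:E)%E.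

Definition finite_energy : {pred V -> C} := [pred u | `[< (energy u < +oo)%E >]].

Let term_ge0 u (e : V * V) : edges N e ->
  0 <= cond N e.1 e.2 * normc (u e.1 - u e.2) ^+ 2.
Proof. by move=> ?; rewrite mulr_ge0 ?sqr_ge0// ltW// cond_gt0. Qed.

Lemma energy_ge0 u : (0 <= energy u)%E.
Proof.
rewrite /energy mule_ge0 ?lee_fin ?invr_ge0//; apply: esum_ge0 => e.
exact: term_ge0.
Qed.

Let sumE u :=
  (\esum_(e in edges N) (cond N e.1 e.2 * normc (u e.1 - u e.2) ^+ 2)%:E)%E.

Let finite_energyE u : (u \in finite_energy) = (sumE u < +oo)%E.
Proof.
rewrite inE/= asboolb /energy -/(sumE u).
have : (0 <= sumE u)%E by apply: esum_ge0 => e; exact: term_ge0.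
case: (sumE u) => [r| |]// _; first by rewrite -EFinM !ltry.
by rewrite gt0_muley ?lte_fin ?invr_gt0.
Qed.

Lemma finite_energy_subsemimod : subsemimod_closed finite_energy.
Proof.
split; first split.
- rewrite finite_energyE [sumE _]esum1// => e _.
  have -> : (0 : V -> C) e.1 - (0 : V -> C) e.2 = 0 by exact: subrr.
  by rewrite normc0 expr0n/= mulr0.
- move=> u v; rewrite !finite_energyE => uF vF.
  apply: (@le_lt_trans _ _ (2%:E * sumE u + 2%:E * sumE v)%E).
    apply: (@le_trans _ _ (\esum_(e in edges N)
      ((2 * (cond N e.1 e.2 * normc (u e.1 - u e.2) ^+ 2))%:E +
       (2 * (cond N e.1 e.2 * normc (v e.1 - v e.2) ^+ 2))%:E))%E).
      apply: le_esum => e eN; rewrite -EFinD lee_fin.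
      rewrite !(mulrCA 2) -mulrDr ler_wpM2l ?(ltW (cond_gt0 _))//.
      set a := u e.1 - u e.2; set b := v e.1 - v e.2.
      have -> : (u + v) e.1 - (u + v) e.2 = a + b by rewrite /a /b addrACA opprD.
      have := le_normcD a b; set p := normc a; set q := normc b => pq.
      have n0 : 0 <= normc (a + b) by case: (a + b) => ? ?; exact: sqrtr_ge0.
      apply: (@le_trans _ _ ((p + q) ^+ 2)).
        by rewrite lerXn2r ?nnegrE// (le_trans n0).
      rewrite -subr_ge0 (_ : _ - _ = (p - q) ^+ 2) ?sqr_ge0//.
      by rewrite sqrrD sqrrB !mulr2n !mulrDl !mul1r; ring.
    rewrite esumD; last 2 first.
    + by move=> e eN; rewrite lee_fin mulr_ge0// term_ge0.
    + by move=> e eN; rewrite lee_fin mulr_ge0// term_ge0.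
    by apply: leeD; apply: le_esumZ => // e; exact: term_ge0.
  by apply: lte_add_pinfty; rewrite lte_mul_pinfty ?lee_fin.
- move=> a u; rewrite !finite_energyE => uF.
  apply: (@le_lt_trans _ _ ((normc a ^+ 2)%:E * sumE u)%E); last first.
    by rewrite lte_mul_pinfty// lee_fin sqr_ge0.
  apply: le_trans (le_esumZ _ _) => //; [|exact: sqr_ge0|exact: term_ge0].
  apply: le_esum => e eN; rewrite lee_fin.
  have -> : (a *: u) e.1 - (a *: u) e.2 = a * (u e.1 - u e.2) by rewrite mulrBr.
  by rewrite normcM exprMn mulrCA.
Qed.

HB.instance Definition _ := GRing.isSubmodClosed.Build C (V -> C) finite_energy
  finite_energy_subsemimod.

Record fin_energy_fun := FinEnergyFun {
  fin_energy_val :> V -> C;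
  _ : fin_energy_val \in finite_energy
}.

HB.instance Definition _ := [isSub for fin_energy_val].
HB.instance Definition _ := [Choice of fin_energy_fun by <:].
HB.instance Definition _ := [SubChoice_isSubLmodule of fin_energy_fun by <:].

Definition constant_fun : {pred fin_energy_fun} :=
  [pred u : fin_energy_fun | `[< forall x y, u x = u y >]].

Lemma constant_fun_subsemimod : subsemimod_closed constant_fun.
Proof.
split; first split.
- by apply/asboolP => x y.
- move=> u v /asboolP uc /asboolP vc; apply/asboolP => x y.
  by rewrite /= /GRing.add/= (uc x y) (vc x y).
- by move=> a u /asboolP uc; apply/asboolP => x y; congr (_ * _).
Qed.

HB.instance Definition _ := GRing.isSubmodClosed.Build C fin_energy_fun
  constant_fun constant_fun_subsemimod.

Definition HE : Type := Quotient.quot constant_fun.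

HB.instance Definition _ := ZmodQuotient.on HE.

Definition scaleHE (a : C) : HE -> HE := lift_op1 HE ( *:%R a).

Lemma pi_scaleHE a : {morph \pi_HE : u / a *: u >-> scaleHE a u}.
Proof.
move=> u; unlock scaleHE; apply/eqP; rewrite -Quotient.idealrBE -scalerBr.
by rewrite rpredZ// Quotient.idealrBE reprK.
Qed.

Let scaleHEA a b (u : HE) : scaleHE a (scaleHE b u) = scaleHE (a * b) u.
Proof. by rewrite -[u]reprK -!pi_scaleHE scalerA. Qed.

Let scaleHE1 : left_id 1 scaleHE.
Proof. by move=> u; rewrite -[u]reprK -pi_scaleHE scale1r. Qed.

Let scaleHEDr : right_distributive scaleHE +%R.
Proof.
move=> a u v; rewrite -[u]reprK -[v]reprK -!pi_scaleHE -!pi_addr.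
by rewrite -pi_scaleHE scalerDr.
Qed.

Let scaleHEDl (u : HE) : {morph scaleHE^~ u : a b / a + b}.
Proof. by move=> a b; rewrite -[u]reprK -!pi_scaleHE -pi_addr scalerDl. Qed.

HB.instance Definition _ := GRing.Zmodule_isLmodule.Build C HE
  scaleHEA scaleHE1 scaleHEDr scaleHEDl.

(* The value u(x) of a class modulo constants is meaningless, but the difference
   u(x) - u(y) does not depend on the representative, see [vdiff_pi]. *)
Definition vdiff (u : HE) (x y : V) : C := repr u x - repr u y.

Lemma vdiff_pi (u : fin_energy_fun) x y : vdiff (\pi_HE u) x y = u x - u y.
Proof.
have : repr (\pi_HE u) - u \in constant_fun by rewrite Quotient.idealrBE reprK.
move=> /asboolP/(_ x y) h.
have e : repr (\pi_HE u) x = repr (\pi_HE u) y - u y + u x.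
  by rewrite -[LHS](subrK (u x)); congr (_ + _); exact: h.
by rewrite /vdiff e; ring.
Qed.

Definition ip (u v : HE) : C :=
  2^-1 * csum (edges N) (fun e =>
    (cond N e.1 e.2)%:C * (vdiff u e.1 e.2)^* * vdiff v e.1 e.2).

Lemma ip_energy (u : fin_energy_fun) :
  ip (\pi_HE u) (\pi_HE u) = (fine (energy u))%:C.
Proof.
rewrite /ip /csum.
have term e : (cond N e.1 e.2)%:C * (vdiff (\pi_HE u) e.1 e.2)^* *
    vdiff (\pi_HE u) e.1 e.2 =
    (cond N e.1 e.2 * normc (u e.1 - u e.2) ^+ 2)%:C.
  rewrite vdiff_pi; case: (u e.1 - u e.2) => p q.
  rewrite /= sqr_sqrtr ?addr_ge0 ?sqr_ge0//.
  by simpc; congr (_ +i* _); ring.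
under [X in X +i* _]eq_rsum do rewrite term.
under [X in _ +i* X]eq_rsum do rewrite term.
rewrite /= rsum_ge0//; last exact: term_ge0.
rewrite [X in _ +i* X]rsum_ge0// [X in _ +i* fine X]esum1//=.
rewrite /energy; set S := esum _ _.
have : S \is a fin_num.
  rewrite ge0_fin_numE; last by apply: esum_ge0 => e; exact: term_ge0.
  by rewrite -[S]/(sumE u) -finite_energyE (valP u).
move=> /fineK <-; rewrite -EFinM /=.
by rewrite rmorphM/= fmorphV rmorph_nat.
Qed.


(* By Riesz representation exactly one vector satisfies this, so that the
   default value 0 is never taken. *)
Definition dipole (x y : V) : HE :=
  xget 0 [set v | forall u : HE, ip v u = vdiff u x y].

Definition orientation (O : set (V * V)) : Prop :=
  O `<=` edges N /\
  forall x y, adj N x y ->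
    (O (x, y) /\ ~ O (y, x)) \/ (~ O (x, y) /\ O (y, x)).

End EnergySpace.

(* [inner u u] is the squared norm of [u], hence real; for the energy space this
   is [ip_energy]. *)
Definition parseval_frame (R : realType) (H : lmodType R[i])
    (inner : H -> H -> R[i]) (I : choiceType) (J : set I) (w : I -> H) : Prop :=
  [/\ countable J,
      forall j, J j -> w j != 0 &
      forall u, \esum_(j in J) (normc (inner (w j) u) ^+ 2)%:E =
                (complex.Re (inner u u))%:E].

(* Main.v *)
Require Import Defs.
From mathcomp Require Import all_boot all_order all_algebra complex.
From mathcomp Require Import boolp classical_sets reals.
From mathcomp Require Import cardinality fsbigop.
From mathcomp Require Import ereal esum numfun topology normedtype sequences.
From mathcomp Require Import ring lra.

(** Once the dipoles are known to reproduce differences, the frame identity is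
    a computation: [<sqrt c_xy v_xy, u> = sqrt c_xy (u x - u y)]
    ([ip_scalel], [ip_dipole]), so the sum over an orientation of the squared
    moduli is the sum of [c_xy |u x - u y|^2] over one representative of each
    undirected edge, which is half the sum over all directed edges, i.e. the
    energy of [u] ([esum_orientation]).

    The substance is the existence of the dipoles, that is, the Riesz
    representation of [u |-> u x - u y] ([dirichlet_riesz]). It is obtained
    variationally, and for real functions only: a real [v] pairs with the real
    and imaginary parts of a complex [u] separately ([ip_real]). Among the real
    functions with [u x - u y = 1], let [v] be one of minimal Dirichlet sum
    ([dirichlet_minimizer]). Varying [v] in directions [w] with [w x = w y]
    shows that [v] is orthogonal to all of them
    ([dirichlet_minimizer_orth]); since every [u] differs from
    [(u x - u y) v] by such a direction, a multiple of [v] represents the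
    functional.

    Existence of the minimizer follows the usual Hilbert space argument. By the
    parallelogram law a minimizing sequence is Cauchy for the energy. Chaining
    along a path, a difference of values is controlled by the energy
    ([dirichlet_bound]), so the sequence, normalized to vanish at [y],
    converges pointwise; and the energy is lower semicontinuous under pointwise
    convergence ([dirichlet_lsc]), because it is a supremum of finite sums. *)

Set Implicit Arguments.
Unset Strict Implicit.
Unset Printing Implicit Defensive.
Import Order.TTheory GRing.Theory Num.Theory.
Import ComplexField.Normc numFieldNormedType.Exports.
Local Open Scope classical_set_scope.
Local Open Scope ring_scope.
Local Open Scope complex_scope.

(** * Linearity of unordered sums *)

Section Summation.
Context {R : realType} {I : choiceType}.
Implicit Types (D : set I) (f g : I -> R).

Lemma esumZ D k f : 0 < k -> (forall i, D i -> 0 <= f i) ->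
  (\esum_(i in D) (k * f i)%:E = k%:E * \esum_(i in D) (f i)%:E)%E.
Proof.
move=> k0 f0; apply/eqP; rewrite eq_le le_esumZ ?(ltW k0)//=.
have kf0 i : D i -> 0 <= k * f i.
  by move=> Di; rewrite mulr_ge0 ?(ltW k0) ?f0.
rewrite -lee_pdivlMl//.
apply: le_trans (le_esumZ _ kf0); last by rewrite invr_ge0 ltW.
by apply: le_esum => i Di; rewrite mulKf ?gt_eqF.
Qed.

Lemma ge0_fin_esum D f : (forall i, D i -> 0 <= f i) ->
  (\esum_(i in D) (f i)%:E < +oo)%E -> \esum_(i in D) (f i)%:E \is a fin_num.
Proof. by move=> f0 foo; rewrite ge0_fin_numE// esum_ge0. Qed.

(** Any splitting of a family into a difference of two nonnegative summable ones
    computes [rsum], not only the one into positive and negative parts; this is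
    what makes [rsum] additive. *)
Lemma rsum_sub D f g :
  (forall i, D i -> 0 <= f i) -> (forall i, D i -> 0 <= g i) ->
  (\esum_(i in D) (f i)%:E < +oo)%E -> (\esum_(i in D) (g i)%:E < +oo)%E ->
  rsum D (fun i => f i - g i) =
  fine (\esum_(i in D) (f i)%:E) - fine (\esum_(i in D) (g i)%:E).
Proof.
move=> f0 g0 foo goo.
have pos (h : I -> R) : (forall i, D i -> 0 <= h i) ->
    \esum_(i in D) (Num.max (h i) 0)%:E = \esum_(i in D) (h i)%:E.
  by move=> h0; apply: eq_esum => i /h0 hi; rewrite max_l.
have sm (h : I -> R) : (forall i, D i -> 0 <= h i) ->
    (\esum_(i in D) (h i)%:E < +oo)%E ->
    summable D (EFin \o h).
  move=> h0; apply: le_lt_trans; apply: le_esum => i /h0 hi /=.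
  by rewrite ger0_norm.
have part (k1 k2 : I -> R) :
    (forall i, D i -> 0 <= k1 i) -> (forall i, D i -> 0 <= k2 i) ->
    (\esum_(i in D) (k1 i)%:E < +oo)%E ->
    \esum_(i in D) (Num.max (k1 i - k2 i) 0)%:E \is a fin_num.
  move=> k10 k20 k1oo.
  apply: ge0_fin_esum => [i _|]; first by rewrite le_max lexx orbT.
  apply: le_lt_trans k1oo; apply: le_esum => i Di; rewrite lee_fin ge_max k10//.
  by rewrite gerBl k20.
have fpos := part _ _ f0 g0 foo.
have fneg : \esum_(i in D) (Num.max (- (f i - g i)) 0)%:E \is a fin_num.
  by under eq_esum do rewrite opprB; exact: part.
rewrite /rsum -!fineB// ?ge0_fin_esum//; congr fine.
apply: etrans (esumB (sm _ f0 foo) (sm _ g0 goo) f0 g0).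
congr (_ - _)%E; apply: eq_esum => i _.
  by rewrite EFin_max funeposE.
by rewrite EFin_max funenegE.
Qed.

Lemma rsumD D f g : summable D (EFin \o f) -> summable D (EFin \o g) ->
  rsum D (fun i => f i + g i) = rsum D f + rsum D g.
Proof.
have p0 (x : R) : 0 <= Num.max x 0 by rewrite le_max lexx orbT.
have poo (h : I -> R) : summable D (EFin \o h) ->
    (\esum_(i in D) (Num.max (h i) 0)%:E < +oo)%E /\
    (\esum_(i in D) (Num.max (- h i) 0)%:E < +oo)%E.
  move=> hs; split; apply: le_lt_trans hs; apply: le_esum => i _ /=;
    by rewrite lee_fin ge_max normr_ge0 ?ler_norm// -normrN ler_norm.
move=> /poo[fp fm] /poo[gp gm].
rewrite (@eq_rsum _ _ _ _ (fun i => (Num.max (f i) 0 + Num.max (g i) 0) -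
  (Num.max (- f i) 0 + Num.max (- g i) 0))); last first.
  have maxB (x : R) : x = Num.max x 0 - Num.max (- x) 0.
    by rewrite -[LHS]subr0 /Num.max; do 2 case: ifPn; lra.
  by move=> i; rewrite [f i in LHS]maxB [g i in LHS]maxB; ring.
have adde (a b : I -> R) :
    (forall i, D i -> 0 <= a i) -> (forall i, D i -> 0 <= b i) ->
    \esum_(i in D) (a i + b i)%:E =
    (\esum_(i in D) (a i)%:E + \esum_(i in D) (b i)%:E)%E.
  by move=> a0 b0; rewrite -esumD.
have s0 (x y : R) : 0 <= Num.max x 0 + Num.max y 0 by rewrite addr_ge0.
rewrite rsum_sub//; do ?by rewrite adde// lte_add_pinfty.
rewrite !adde// !fineD// ?ge0_fin_esum// /rsum; ring.
Qed.

Lemma rsumN D f : rsum D (fun i => - f i) = - rsum D f.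
Proof.
rewrite /rsum opprB; congr (_ - fine _).
by apply: eq_esum => i _; rewrite opprK.
Qed.

(** This holds for every family: a part with infinite sum contributes 0 through
    [fine], before and after scaling. *)
Lemma rsumZ D k f : rsum D (fun i => k * f i) = k * rsum D f.
Proof.
have pos l : 0 < l -> rsum D (fun i => l * f i) = l * rsum D f.
  move=> l0; have h (g : I -> R) :
      fine (\esum_(i in D) (Num.max (l * g i) 0)%:E) =
      l * fine (\esum_(i in D) (Num.max (g i) 0)%:E).
    transitivity (fine (\esum_(i in D) (l * Num.max (g i) 0)%:E)).
      by congr fine; apply: eq_esum => i _; rewrite maxr_pMr ?mulr0// ltW.
    rewrite esumZ//; last by move=> i _; rewrite le_max lexx orbT.
    case: (esum _ _) => [r| |] //=.
    all: rewrite ?gt0_muley ?gt0_muleNy ?lte_fin//= ?mulr0//.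
  rewrite /rsum mulrBr -!h; congr (_ - fine _).
  by apply: eq_esum => i _; rewrite mulrN.
have [k0|k0|->] := ltgtP k 0; last 1 first.
- rewrite (@eq_rsum _ _ _ _ (fun=> 0)); last by move=> i; rewrite mul0r.
  by rewrite rsum_ge0// esum1// mul0r.
- rewrite (@eq_rsum _ _ _ _ (fun i => - (- k * f i))); last by move=> i; ring.
  by rewrite rsumN pos ?oppr_gt0//; ring.
- exact: pos.
Qed.

End Summation.

(** * The Dirichlet sum of a real function *)

Section Dirichlet.
Context {R : realType} {V : countType} (N : network R V).
Implicit Types (u v w : V -> R) (x y : V).

(** Both directions of an edge are summed, so this is twice the energy. *)
Definition dirichlet u : \bar R :=
  (\esum_(e in edges N) (cond N e.1 e.2 * (u e.1 - u e.2) ^+ 2)%:E)%E.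

Definition dirichlet_form u v : R :=
  rsum (edges N) (fun e =>
    cond N e.1 e.2 * ((u e.1 - u e.2) * (v e.1 - v e.2))).

Let cond_ge0 e : edges N e -> 0 <= cond N e.1 e.2.
Proof. by move=> ?; rewrite ltW// cond_gt0. Qed.

Let term_ge0 u e : edges N e -> 0 <= cond N e.1 e.2 * (u e.1 - u e.2) ^+ 2.
Proof. by move=> /cond_ge0 ?; rewrite mulr_ge0// sqr_ge0. Qed.

Lemma dirichlet_ge0 u : (0 <= dirichlet u)%E.
Proof. by apply: esum_ge0 => e /(term_ge0 u). Qed.

Lemma dirichlet_fin_num u : (dirichlet u < +oo)%E -> dirichlet u \is a fin_num.
Proof. by move=> uoo; rewrite ge0_fin_numE// dirichlet_ge0. Qed.

Lemma dirichletZ k u : k != 0 ->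
  dirichlet (fun x => k * u x) = ((k ^+ 2)%:E * dirichlet u)%E.
Proof.
move=> k0; rewrite /dirichlet -esumZ ?exprn_even_gt0//; last exact: term_ge0.
by apply: eq_esum => e _; congr EFin; ring.
Qed.

Lemma dirichlet_shift k u : dirichlet (fun x => u x - k) = dirichlet u.
Proof. by apply: eq_esum => e _; congr EFin; ring. Qed.

Lemma dirichlet_parallelogram u v :
  (dirichlet (fun x => u x + v x)%R + dirichlet (fun x => u x - v x)%R =
   2%:E * dirichlet u + 2%:E * dirichlet v)%E.
Proof.
have t0 w e : edges N e -> (0 <= (cond N e.1 e.2 * (w e.1 - w e.2) ^+ 2)%:E)%E.
  by move=> eN; rewrite lee_fin term_ge0.
have t2 w e : edges N e ->
    (0 <= (2 * (cond N e.1 e.2 * (w e.1 - w e.2) ^+ 2))%:E)%E.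
  by move=> eN; rewrite lee_fin mulr_ge0// term_ge0.
rewrite /dirichlet -esumD; last 2 first.
- exact: (t0 (fun x => _ x + _ x)).
- exact: (t0 (fun x => _ x - _ x)).
rewrite -!esumZ//; try exact: term_ge0.
rewrite -esumD; try exact: t2.
by apply: eq_esum => e _; rewrite -!EFinD; congr EFin; ring.
Qed.

Lemma dirichletD_lty u v : (dirichlet u < +oo)%E -> (dirichlet v < +oo)%E ->
  (dirichlet (fun x => u x + v x)%R < +oo)%E.
Proof.
move=> uoo voo.
apply: (@le_lt_trans _ _ (2%:E * dirichlet u + 2%:E * dirichlet v)%E).
  by rewrite -dirichlet_parallelogram leeDl// dirichlet_ge0.
by apply: lte_add_pinfty; rewrite lte_mul_pinfty// lee_fin.
Qed.

Lemma dirichletZ_lty k u : (dirichlet u < +oo)%E ->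
  (dirichlet (fun x => k * u x)%R < +oo)%E.
Proof.
move=> uoo; have [->|k0] := eqVneq k 0.
  by rewrite [dirichlet _]esum1// => e _; rewrite !mul0r subrr expr0n mulr0.
by rewrite dirichletZ// lte_mul_pinfty// lee_fin sqr_ge0.
Qed.

(** Along a path from [x] to [y], induction on its length and
    [(a + b)^2 <= 2 a^2 + 2 b^2] bound the difference by the finitely many edge
    terms met. Taking [K > 0] keeps the bound meaningful when the Dirichlet sum
    is infinite. *)
Lemma dirichlet_bound x y :
  exists2 K : R, 0 < K &
    forall u, (((u x - u y) ^+ 2)%:E <= K%:E * dirichlet u)%E.
Proof.
have [p []] := adj_conn N x y; elim: p x => [|z p IH] x /=.
  move=> _ ->; exists 1 => // u.
  by rewrite subrr expr0n/= mul1e dirichlet_ge0.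
move=> /andP[xz /IH{}IH] /IH[K K0 Ku].
exists (2 * (cond N x z)^-1 + 2 * K).
  by rewrite addr_gt0 ?mulr_gt0 ?invr_gt0 ?(cond_gt0 xz).
move=> u; have zy := Ku u.
have xz_le : (((u x - u z) ^+ 2)%:E <= (cond N x z)^-1%:E * dirichlet u)%E.
  rewrite lee_pdivlMl ?(cond_gt0 xz)// -EFinM.
  apply: esum_ge; exists [set (x, z)]; last by rewrite fsbig_set1.
  by split; [exact: finite_set1 | move=> _ ->].
have c0 := ltW (cond_gt0 xz).
rewrite EFinD ge0_muleDl ?lee_fin ?mulr_ge0 ?invr_ge0 ?(ltW K0)//.
rewrite !EFinM -!muleA.
apply: (@le_trans _ _ (2%:E * ((u x - u z) ^+ 2)%:E +
                         2%:E * ((u z - u y) ^+ 2)%:E)%E).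
  rewrite -!EFinM -EFinD lee_fin -subr_ge0.
  by rewrite (_ : _ - _ = (u x - 2 * u z + u y) ^+ 2) ?sqr_ge0//; ring.
by rewrite leeD// lee_wpmul2l// lee_fin.
Qed.

(** Local finiteness: only the finitely many directed edges that enter or leave
    [x] contribute. *)
Lemma dirichlet_delta x : (dirichlet (fun z => (z == x)%:R)%R < +oo)%E.
Proof.
pose F := (pair x @` [set y | adj N x y]) `|` (pair^~ x @` [set y | adj N x y]).
have finF : finite_set F.
  by rewrite finite_setU; split; apply: finite_image; exact: adj_fin.
have FN : F `<=` edges N.
  by move=> _ [] [y xy <-]; rewrite /edges/= // adj_sym.
have t0 := term_ge0 (fun z => (z == x)%:R).
rewrite /dirichlet (esumID F); last by move=> e /t0.
rewrite [X in (_ + X)%E]esum1 ?adde0; last first.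
  move=> [a b] [/= ab nF]; have ax : (a == x) = false.
    by apply/eqP => ax; apply: nF; left; exists b; rewrite -?ax.
  have bx : (b == x) = false.
    by apply/eqP => bx; apply: nF; right; exists a; rewrite -?bx//= adj_sym.
  by rewrite ax bx subrr expr0n mulr0.
rewrite setIidr// esum_fset//; last by move=> e /[!inE] /FN /t0.
by rewrite fsumEFin// ltry.
Qed.

(** Each finite partial sum passes to the pointwise limit, and the Dirichlet sum
    is the supremum of these. *)
Lemma dirichlet_lsc (u_ : nat -> V -> R) u (m : R) :
  (forall x, u_ n x @[n --> \oo] --> u x) ->
  (forall e, 0 < e ->
    \forall n \near \oo, (dirichlet (u_ n) <= (m + e)%:E)%E) ->
  (dirichlet u <= m%:E)%E.
Proof.
move=> uu um; apply: ge_ereal_sup => _ [A [finA AN] <-].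
rewrite fsumEFin// lee_fin; apply/ler_addgt0Pr => e e0.
have : (\sum_(i \in A) (cond N i.1 i.2 * (u_ n i.1 - u_ n i.2) ^+ 2))
    @[n --> \oo] --> \sum_(i \in A) (cond N i.1 i.2 * (u i.1 - u i.2) ^+ 2).
  rewrite [X in _ --> X]fsbig_finite//=.
  under eq_fun do rewrite fsbig_finite//=.
  apply: cvg_big => [|i _]; first exact: add_continuous.
  apply: cvgM; first exact: cvg_cst.
  by apply: cvgM; apply: cvgB; exact: uu.
move=> h; apply: (cvgr_to_le h).
near=> n.
rewrite -lee_fin -fsumEFin//.
apply: le_trans (_ : (dirichlet (u_ n) <= _)%E); last by near: n; exact: um.
by apply: esum_ge; exists A.
Unshelve. all: by end_near.
Qed.

End Dirichlet.

(** * Riesz representation of a difference of values *)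

Section Riesz.
Context {R : realType} {V : countType} (N : network R V).
Implicit Types (u v w : V -> R) (x y : V).
Local Notation Q := (dirichlet N).

(** The constraint is convex, so the midpoint of two competitors is a
    competitor; the parallelogram law then forces a minimizing sequence to be
    Cauchy. *)
Lemma dirichlet_minimizer x y : x != y ->
  exists v, [/\ v x - v y = 1, (Q v < +oo)%E &
    forall u, u x - u y = 1 -> (Q v <= Q u)%E].
Proof.
move=> xy; pose S := Q @` [set u | u x - u y = 1].
have Q0 := @dirichlet_ge0 R V N.
have Sfin : ereal_inf S \is a fin_num.
  rewrite ge0_fin_numE; last by apply: le_ereal_inf_tmp => _ [u _ <-].
  apply: le_lt_trans (dirichlet_delta N x); apply: ereal_inf_lbound.
  by exists (fun z => (z == x)%:R) => //=; rewrite eqxx eq_sym (negPf xy) subr0.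
have [m Sm] : exists m, ereal_inf S = m%:E.
  by exists (fine (ereal_inf S)); rewrite fineK.
have mQ u : u x - u y = 1 -> (m%:E <= Q u)%E.
  by move=> u1; rewrite -Sm; apply: ereal_inf_lbound; exists u.
have approx n : exists u,
    [/\ u x = 1, u y = 0 & (Q u <= (m + n.+1%:R^-1)%:E)%E].
  have n0 : 0 < n.+1%:R^-1 :> R by rewrite invr_gt0.
  have [_ [u /= u1 <-] /ltW um] := lb_ereal_inf_adherent n0 Sfin.
  exists (fun z => u z - u y); split; rewrite ?subrr//.
  by rewrite dirichlet_shift EFinD -Sm.
have [u_ u_P] := choice approx.
(* the midpoint of [u_ n] and [u_ k] has Dirichlet sum at least [m] *)
have u_cauchy n k : (Q (fun z => u_ n z - u_ k z)%R <=
    (2 * n.+1%:R^-1 + 2 * k.+1%:R^-1)%:E)%E.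
  have [nx ny Qn] := u_P n; have [kx ky Qk] := u_P k.
  have mid : ((4 * m)%:E <= Q (fun z => u_ n z + u_ k z)%R)%E.
    rewrite (_ : (fun z => _) = (fun z => 2 * (2^-1 * (u_ n z + u_ k z)))); last first.
      by apply/funext => z; rewrite mulVKf.
    rewrite dirichletZ// (_ : 2 ^+ 2 = 4) ?EFinM; last by ring.
    by rewrite lee_wpmul2l ?lee_fin// mQ// nx ny kx ky; field.
  have par := dirichlet_parallelogram N (u_ n) (u_ k).
  have : (Q (fun z => u_ n z + u_ k z)%R + Q (fun z => u_ n z - u_ k z)%R <=
    (2 * (m + n.+1%:R^-1) + 2 * (m + k.+1%:R^-1))%:E)%E.
    by rewrite par (EFinD (2 * _)) !(EFinM 2) leeD// lee_wpmul2l// lee_fin.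
  move: mid (Q0 (fun z => u_ n z - u_ k z)) (Q0 (fun z => u_ n z + u_ k z)).
  case: (Q _) => [s| |]//; case: (Q _) => [t| |]//.
  by rewrite -EFinD !lee_fin; move: n.+1%:R^-1 k.+1%:R^-1 => a b; lra.
(* [u_ n y = 0], so [dirichlet_bound] controls the values themselves *)
have u_cvg z : exists l : R, u_ n z @[n --> \oo] --> l.
  have [K K0 KQ] := dirichlet_bound N z y.
  have Kc n k : (u_ n z - u_ k z) ^+ 2 <= K * (2 * n.+1%:R^-1 + 2 * k.+1%:R^-1).
    have [_ ny _] := u_P n; have [_ ky _] := u_P k.
    rewrite -lee_fin (EFinM K).
    apply: le_trans (_ : (K%:E * Q (fun z => u_ n z - u_ k z)%R <= _)%E).
      by apply: le_trans (KQ _); rewrite ny ky subrr subr0.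
    by rewrite lee_wpmul2l// lee_fin ltW.
  suff uc : cvg (u_ n z @[n --> \oo]) by exists (lim (u_ n z @[n --> \oo])).
  apply/cauchy_cvgP/cauchy_ballP => e e0; near_simpl.
  have small : \forall n \near \oo, n.+1%:R^-1 < e ^+ 2 / (4 * K) :> R.
    have e'0 : 0 < e ^+ 2 / (4 * K) by rewrite divr_gt0 ?exprn_gt0 ?mulr_gt0.
    exact: (near_infty_natSinv_lt (PosNum e'0)).
  near=> n k => /=; rewrite -ball_normE/=.
  rewrite -(ltr_pXn2r (n:=2))// ?nnegrE ?(ltW e0)//.
  rewrite real_normK ?num_real//; apply: le_lt_trans (Kc n k) _.
  rewrite -ltr_pdivlMl//.
  have : n.+1%:R^-1 < e ^+ 2 / (4 * K) :> R by near: n.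
  have : k.+1%:R^-1 < e ^+ 2 / (4 * K) :> R by near: k.
  have -> : e ^+ 2 / (4 * K) = (K^-1 * e ^+ 2) / 4 by field; rewrite gt_eqF.
  by move: n.+1%:R^-1 k.+1%:R^-1 (K^-1 * _) => a b c; lra.
have [v u_v] := choice u_cvg.
have vQ : (Q v <= m%:E)%E.
  apply: (dirichlet_lsc u_v) => e e0.
  have small : \forall n \near \oo, n.+1%:R^-1 < e :> R.
    exact: (near_infty_natSinv_lt (PosNum e0)).
  near=> n; have [_ _ /le_trans] := u_P n; apply.
  by rewrite lee_fin lerD2l ltW//; near: n.
exists v; split; last 2 first.
- by apply: le_lt_trans vQ _; rewrite ltry.
- by move=> u /mQ; apply: le_trans vQ.
have cst z l : (forall n, u_ n z = l) -> v z = l.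
  move=> ul; apply: (cvg_unique _ (u_v z)); first exact: Rhausdorff.
  by apply: cvg_near_cst; exact: nearW.
by rewrite (cst x 1) ?(cst y 0) ?subr0// => n; have [] := u_P n.
Unshelve. all: by end_near.
Qed.

(** Termwise, [|a b| <= a^2 + b^2]. *)
Lemma dirichlet_form_summable v w : (Q v < +oo)%E -> (Q w < +oo)%E ->
  summable (edges N) (fun e =>
    (cond N e.1 e.2 * ((v e.1 - v e.2) * (w e.1 - w e.2)))%:E).
Proof.
move=> voo woo.
apply: le_lt_trans (_ : (Q v + Q w < +oo)%E); last first.
  exact: lte_add_pinfty.
have c0 e : edges N e -> 0 <= cond N e.1 e.2.
  by move=> ?; rewrite ltW// cond_gt0.
rewrite /dirichlet -esumD; last 2 first.
- by move=> e /c0 ?; rewrite lee_fin mulr_ge0// sqr_ge0.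
- by move=> e /c0 ?; rewrite lee_fin mulr_ge0// sqr_ge0.
apply: le_esum => e eN; rewrite lee_fin normrM ger0_norm ?c0// -mulrDr.
rewrite ler_wpM2l ?c0// ler_norml.
by set a := v _ - _; set b := w _ - _; nra.
Qed.

Lemma dirichlet_formD u v w : (Q u < +oo)%E -> (Q v < +oo)%E -> (Q w < +oo)%E ->
  dirichlet_form N u (fun x => v x + w x) =
  dirichlet_form N u v + dirichlet_form N u w.
Proof.
move=> uoo voo woo; rewrite -rsumD; try exact: dirichlet_form_summable.
by apply: eq_rsum => e; ring.
Qed.

Lemma dirichlet_formZ k u v :
  dirichlet_form N u (fun x => k * v x) = k * dirichlet_form N u v.
Proof. by rewrite -rsumZ; apply: eq_rsum => e; ring. Qed.

Lemma dirichlet_formC u v : dirichlet_form N u v = dirichlet_form N v u.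
Proof. by apply: eq_rsum => e; ring. Qed.

Lemma dirichlet_formE u : dirichlet_form N u u = fine (Q u).
Proof.
rewrite /dirichlet_form rsum_ge0// => e eN.
by rewrite -expr2 mulr_ge0 ?sqr_ge0// ltW// cond_gt0.
Qed.

(** First variation: [v + t w] satisfies the same constraint as [v], so
    [2 t <v, w> + t^2 <w, w> >= 0] for all [t]. *)
Lemma dirichlet_minimizer_orth x y v : v x - v y = 1 -> (Q v < +oo)%E ->
    (forall u, u x - u y = 1 -> (Q v <= Q u)%E) ->
  forall w, (Q w < +oo)%E -> w x = w y -> dirichlet_form N v w = 0.
Proof.
move=> vxy voo vmin w woo wxy.
set b := dirichlet_form N v w; set q := fine (Q w).
have q0 : 0 <= q by rewrite fine_ge0// dirichlet_ge0.
have var t : 0 <= 2 * t * b + t ^+ 2 * q.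
  have twoo := dirichletZ_lty t woo.
  have vtwoo := dirichletD_lty voo twoo.
  have : fine (Q v) <= fine (Q (fun z => v z + t * w z)).
    by rewrite fine_le ?dirichlet_fin_num// vmin// wxy -vxy; ring.
  rewrite -!dirichlet_formE dirichlet_formD// dirichlet_formZ.
  rewrite !(dirichlet_formC (fun z => _ + _)) !dirichlet_formD//.
  rewrite !dirichlet_formZ (dirichlet_formC w v) -/b.
  by rewrite [dirichlet_form N w w]dirichlet_formE -/q; lra.
have q1 : 0 < q + 1 by rewrite ltr_wpDl.
apply/eqP; rewrite -sqrf_eq0 eq_le sqr_ge0 andbT.
(* the minimum is at [- b / q], but [q] may vanish; [q + 1] works as well *)
have := var (- b / (q + 1)).
have -> : 2 * (- b / (q + 1)) * b + (- b / (q + 1)) ^+ 2 * q =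
    - (b ^+ 2 * (q + 2) / (q + 1) ^+ 2) by field; rewrite gt_eqF.
rewrite oppr_ge0 -mulrA pmulr_lle0// divr_gt0 ?exprn_gt0//.
by rewrite ltr_wpDl.
Qed.

(** With [v] the minimizer and [d := u x - u y], the direction [u - d v]
    takes equal values at [x] and [y], so it is orthogonal to [v],
    whence [<v, u> = d <v, v>]. *)
Lemma dirichlet_riesz x y : x != y -> exists2 g, (Q g < +oo)%E &
  forall u, (Q u < +oo)%E -> dirichlet_form N g u = u x - u y.
Proof.
move=> /dirichlet_minimizer[v [vxy voo vmin]].
have [K K0 /(_ v)] := dirichlet_bound N x y.
set q := fine (Q v) => vK.
(* [v] is not constant, so its Dirichlet sum cannot vanish *)
have q0 : 0 < q.
  move: vK; rewrite vxy expr1n -(fineK (dirichlet_fin_num voo)).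
  rewrite -/q -EFinM lee_fin.
  by rewrite -(pmulr_rgt0 _ K0); apply: lt_le_trans.
exists (fun z => q^-1 * v z); first exact: dirichletZ_lty.
move=> u uoo; pose d := u x - u y.
have dvoo := dirichletZ_lty (- d) voo.
have /(_ _ (dirichletD_lty uoo dvoo)) := dirichlet_minimizer_orth vxy voo vmin.
rewrite dirichlet_formD// dirichlet_formZ dirichlet_formE -/q.
move=> orth; rewrite dirichlet_formC dirichlet_formZ dirichlet_formC -/d.
have -> : dirichlet_form N v u = d * q.
  apply/eqP; rewrite -subr_eq0 -mulNr orth//.
  by move: vxy => /(canRL (subrK _)) ->; rewrite /d; ring.
by rewrite mulrC mulfK// gt_eqF.
Qed.

End Riesz.

(** * Dipoles and orientations *)

Section Dipoles.
Context {R : realType} {V : countType} (N : network R V).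
Implicit Types (x y : V) (u : HE N).
Local Notation Q := (dirichlet N).

Lemma energyE (u : V -> R[i]) : energy N u =
  ((2^-1)%:E *
    (Q (fun x => complex.Re (u x)) + Q (fun x => complex.Im (u x))))%E.
Proof.
have t0 (w : V -> R) e : edges N e ->
    (0 <= (cond N e.1 e.2 * (w e.1 - w e.2) ^+ 2)%:E)%E.
  by move=> eN; rewrite lee_fin mulr_ge0 ?sqr_ge0// ltW// cond_gt0.
rewrite -esumD; last 2 first.
- exact: (t0 (fun x => complex.Re (u x))).
- exact: (t0 (fun x => complex.Im (u x))).
congr (_ * _)%E; apply: eq_esum => -[a b] _ /=; rewrite -EFinD -mulrDr.
case: (u a) (u b) => [p q] [r s] /=.
by rewrite sqr_sqrtr// addr_ge0 ?sqr_ge0.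
Qed.

Lemma finite_energy_parts (u : fin_energy_fun N) :
  (Q (fun x => complex.Re (u x)) < +oo)%E /\
  (Q (fun x => complex.Im (u x)) < +oo)%E.
Proof.
have /asboolP := valP u; rewrite energyE => uoo.
have Soo : (Q (fun x => complex.Re (u x)) +
    Q (fun x => complex.Im (u x)) < +oo)%E.
  by move: uoo; rewrite lte_pdivrMl// ?muly_gt0 ?gt0_muley.
by split; apply: (le_lt_trans _ Soo); rewrite ?leeDl ?leeDr ?dirichlet_ge0.
Qed.

Lemma finite_energy_real (v : V -> R) : (Q v < +oo)%E ->
  (fun x => (v x)%:C) \in finite_energy N.
Proof.
move=> voo; apply/asboolP; rewrite energyE.
rewrite [Q (fun x => complex.Im _)]esum1 ?adde0 ?lte_mul_pinfty ?lee_fin ?invr_ge0//.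
by move=> e _; rewrite subrr expr0n mulr0.
Qed.

(** Pairing with a real function does not mix the real and imaginary parts,
    which reduces the representation problem to real functions. *)
Lemma ip_real (v : V -> R) (voo : (Q v < +oo)%E) u :
  ip (\pi_(HE N)%qT (FinEnergyFun (finite_energy_real voo))) u =
  2^-1 * (dirichlet_form N v (fun x => complex.Re (repr u x)) +i*
          dirichlet_form N v (fun x => complex.Im (repr u x))).
Proof.
rewrite /ip /csum; congr (_ * (_ +i* _)); apply: eq_rsum => e;
  rewrite vdiff_pi /= /vdiff;
  case: (repr u e.1) (repr u e.2) => [p q] [r s] /=; ring.
Qed.

(** By [dirichlet_riesz] some vector reproduces the difference, so that the
    choice made in [dipole] does not fall back on its default value. *)
Lemma ip_dipole x y u : x != y -> ip (dipole N x y) u = vdiff u x y.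
Proof.
move=> /(dirichlet_riesz N)[g goo gP]; rewrite /dipole.
case: xgetP => [v _ -> //|].
(* the factor 2 compensates the [2^-1] in [ip] *)
move=> /(_ (\pi_(HE N)%qT
  (FinEnergyFun (finite_energy_real (dirichletZ_lty 2 goo)))))[].
move=> w; rewrite ip_real.
have [re im] := finite_energy_parts (repr w).
rewrite !(dirichlet_formC _ (fun x => 2 * _)) !dirichlet_formZ.
rewrite !(dirichlet_formC _ _ g) !gP// /vdiff.
case: (repr w x) (repr w y) => [p q] [r s] /=.
have -> : 2^-1 = (2^-1)%:C :> R[i] by rewrite fmorphV rmorph_nat.
by simpc; congr (_ +i* _); field.
Qed.

Lemma vdiffZ k u x y : vdiff (k *: u) x y = k * vdiff u x y.
Proof. by rewrite -[u]reprK -[_ *: _](pi_scaleHE k) !vdiff_pi mulrBr. Qed.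

(** The scalar is real, so that conjugation leaves it unchanged. *)
Lemma ip_scalel (k : R) u v : ip (k%:C *: u) v = k%:C * ip u v.
Proof.
rewrite /ip mulrCA; congr (_ * _); rewrite /csum.
have -> (a b : R) : k%:C * (a +i* b) = (k * a) +i* (k * b) by simpc.
rewrite -!rsumZ; congr (_ +i* _); apply: eq_rsum => e; rewrite vdiffZ;
 case: (vdiff u _ _) (vdiff v _ _) => [p q] [r s] /=; ring.
Qed.

Lemma ip0l u : ip 0 u = 0.
Proof. by rewrite -(scale0r (0 : HE N)) (ip_scalel 0) mul0r. Qed.

(** A dipole separates [x] from [y] when paired with the indicator of [x]. *)
Lemma dipole_neq0 x y : x != y -> dipole N x y != 0.
Proof.
move=> xy; apply/eqP => d0.
have := ip_dipole (\pi_(HE N)%qT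
  (FinEnergyFun (finite_energy_real (dirichlet_delta N x)))) xy.
rewrite d0 ip0l vdiff_pi /= eqxx eq_sym (negPf xy) subr0 => /esym/eqP.
by rewrite oner_eq0.
Qed.

(** Reversing the edges of an orientation gives exactly the remaining directed
    edges. *)
Lemma esum_orientation (O : set (V * V)) (f : V * V -> \bar R) :
    orientation N O -> (forall e, edges N e -> (0 <= f e)%E) ->
    (forall x y, adj N x y -> f (x, y) = f (y, x)) ->
  \esum_(e in edges N) f e = (2%:E * \esum_(e in O) f e)%E.
Proof.
move=> [ON Oor] f0 fC; rewrite (esumID O)// setIidr//.
pose swap (e : V * V) := (e.2, e.1).
have -> : edges N `&` ~` O = swap @` O.
  apply/seteqP; split=> [[a b] [/= ab nO]|_ [[a b] /= Oab <-]].
    by exists (b, a) => //; have [[]|[]] := Oor a b ab.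
  have ab := ON _ Oab; split; first by rewrite /edges/= adj_sym.
  by have [[]|[]] := Oor a b ab.
rewrite esum_image; last by move=> [a b] [c d] _ _ [-> ->].
rewrite [X in (_ + X)%E](_ : _ = \esum_(e in O) f e); last first.
  by apply: eq_esum => -[a b] /ON ab; exact: esym (fC _ _ ab).
rewrite (_ : 2%:E = 1 + 1)%E// ge0_muleDl ?lee_fin// mul1e//.
Qed.

End Dipoles.

Theorem theorem3p8 (R : realType) (V : countType) (N : network R V)
    (O : set (V * V)) (hO : orientation N O) :
  parseval_frame (@ip R V N) O
    (fun e : V * V => (Num.sqrt (cond N e.1 e.2))%:C *: dipole N e.1 e.2).
Proof.
have ON := hO.1.
have neq x y : adj N x y -> x != y.
  by move=> xy; apply: contraTneq xy => ->; exact: adj_irr.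
split.
- exact: countableP.
- move=> [x y] /ON /= xy; rewrite scaler_eq0 negb_or dipole_neq0 ?neq// andbT.
  by rewrite fmorph_eq0 sqrtr_eq0 -ltNge cond_gt0.
move=> u.
pose f (e : V * V) := (cond N e.1 e.2 * normc (vdiff u e.1 e.2) ^+ 2)%:E.
transitivity (\esum_(e in O) f e).
  apply: eq_esum => -[x y] /ON xy; congr EFin.
  rewrite (ip_scalel (Num.sqrt _)) ip_dipole ?(neq _ _ xy)// normcM exprMn.
  congr (_ * _); rewrite /= expr0n addr0 sqrtr_sqr.
  by rewrite ger0_norm ?sqrtr_ge0// sqr_sqrtr// ltW// cond_gt0.
have f0 e : edges N e -> (0 <= f e)%E.
  by move=> eN; rewrite lee_fin mulr_ge0 ?sqr_ge0// ltW// cond_gt0.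
have fE : energy N (repr u) = \esum_(e in O) f e.
  rewrite /energy (esum_orientation (f := f) hO)//.
    by rewrite muleA -EFinM mulVf// mul1e.
  move=> x y xy; rewrite /f /= (cond_sym xy) /vdiff -opprB.
  by case: (_ - _) => p q /=; rewrite !sqrrN.
rewrite -[in RHS](reprK u) ip_energy /= fineK -?fE//.
have [re im] := finite_energy_parts (repr u).
by rewrite energyE fin_numM// fin_numD !dirichlet_fin_num.
Qed.
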